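(* Let $\mathcal{H}$ be a nonempty regular $3$-uniform hypergraph. Then there is a spanning subhypergraph $\mathcal{C}\subseteq \mathcal{H}$ such that $\deg_{\mathcal{C}} v\in \{1, 2, 3\}$ for all $v\in V(\mathcal{H})$.
   Context: A hypergraph $\mathcal{H}$ consists of a finite vertex set $V(\mathcal{H})$ and a set $E(\mathcal{H})$ of subsets of $V(\mathcal{H})$, called edges. It is nonempty if it has at least one edge. It is $r$-uniform if every edge has exactly $r$ vertices. The degree $\deg_{\mathcal{H}} v$ of a vertex $v$ is the number of edges containing $v$; $\mathcal{H}$ is $d$-regular if every vertex has degree $d$, and regular if it is $d$-regular for some $d$. A spanning subhypergraph $\mathcal{C}\subseteq\mathcal{H}$ is a hypergraph with $V(\mathcal{C})=V(\mathcal{H})$ and $E(\mathcal{C})\subseteq E(\mathcal{H})$. *)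

(* Defs.v *)
From mathcomp Require Import all_boot.

Set Implicit Arguments.
Unset Strict Implicit.
Unset Printing Implicit Defensive.

(* A hypergraph with vertex set the finite type V is identified with its set
   of edges.  Hypergraphs on the same V have the same vertex set, so C is a
   spanning subhypergraph of H exactly when E(C) is included in E(H). *)
Definition hypergraph (V : finType) := {set {set V}}.

Definition nonempty (V : finType) (H : hypergraph V) : Prop :=
  exists e : {set V}, e \in H.

Definition uniform (V : finType) (r : nat) (H : hypergraph V) : Prop :=
  forall e : {set V}, e \in H -> #|e| = r.

Definition degree (V : finType) (H : hypergraph V) (v : V) : nat :=
  #|[set e in H | v \in e]|.

Definition regular_of_degree (V : finType) (d : nat) (H : hypergraph V) : Prop :=
  forall v : V, degree H v = d.

Definition regular (V : finType) (H : hypergraph V) : Prop :=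
  exists d : nat, regular_of_degree d H.

Definition spanning_subhypergraph (V : finType) (C H : hypergraph V) : Prop :=
  C \subset H.

(* Main.v *)
Require Import Defs.
From mathcomp Require Import all_boot.
From mathcomp Require Import all_order all_fingroup all_algebra zify lra.

(** Beck-Fiala rounding, for degree [d > 1].  Start from the weights
    [x e = 2 / d], whose sum at every vertex is [2], and call an edge fractional
    if [0 < x e < 1].  Let [W] be the set of vertices on at least three
    fractional edges; by double counting there are at most as many of them as
    fractional edges.  While some nonzero [y], supported on the fractional edges,
    sums to zero at all vertices of [W], moving [x] along [y] makes one more edge
    integral.  A vertex that leaves [W] with sum [2] has final degree in {1, 2, 3}
    however the remaining edges are rounded.  When no such [y] is left, the
    incidence matrix of [W] and the fractional edges is square and invertible,
    every vertex of [W] is on exactly three fractional edges and on at most one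
    edge of weight [1], and a nonzero term in the expansion of the determinant
    matches [W] into the fractional edges.  The edge matched to a vertex is
    rounded down if that vertex is on an edge of weight [1], and up otherwise;
    the remaining fractional edges are irrelevant. *)

Set Implicit Arguments.
Unset Strict Implicit.
Unset Printing Implicit Defensive.

Import Order.TTheory GRing.Theory Num.Theory.
Local Open Scope ring_scope.

(** * Linear algebra: a kernel vector or a matching *)

Lemma row_free_matching (K : fieldType) m n (M : 'M[K]_(m, n)) :
    row_free M -> (n <= m)%N ->
  n = m /\ exists2 f : 'I_n -> 'I_m, injective f & forall j, M (f j) j != 0.
Proof.
move=> M_free le_nm; have eq_nm : n = m.
  by apply/eqP; rewrite eqn_leq le_nm -(eqP M_free) rank_leq_col.
split=> //; subst n; have /negP detM : \det M != 0.
  by rewrite -unitfE -unitmxE -row_free_unit.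
(* Some term of the Leibniz expansion of the nonzero determinant has no zero factor; the inverse of
   its permutation is the matching. *)
have [/existsP[s /forallP Ms] | /existsPn noperm] :=
  boolP [exists s : 'S_m, [forall i, M i (s i) != 0]].
  exists (s^-1)%g => [|j]; first exact: perm_inj.
  by have := Ms ((s^-1)%g j); rewrite permKV.
case: detM; apply/eqP/big1 => s _.
have /forallPn[i] := noperm s; rewrite negbK => /eqP Mi0.
by rewrite (bigD1 i) //= Mi0 mul0r mulr0.
Qed.

(* [e0] is only a junk value for [g] outside [W]. *)
Lemma kernel_or_matching (K : fieldType) (E V : finType) (a : E -> V -> K)
    (e0 : E) (F : {set E}) (W : {set V}) : (#|W| <= #|F|)%N ->
    (exists y : E -> K, [/\ exists e, y e != 0, forall e, e \notin F -> y e = 0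
       & forall v, v \in W -> \sum_e y e * a e v = 0])
    \/ (#|W| = #|F| /\ exists2 g : V -> E, {in W &, injective g}
          & forall v, v \in W -> g v \in F /\ a (g v) v != 0).
Proof.
move=> le_WF; pose M : 'M[K]_(#|F|, #|W|) :=
  \matrix_(i, j) a (enum_val i) (enum_val j).
have [M_free | ] := boolP (row_free M).
  right; have [eqWF [f f_inj Mf]] := row_free_matching M_free le_WF.
  split=> //; have [W0 | [v0 v0W]] := set_0Vmem W.
    by exists (fun=> e0) => v; rewrite W0 inE.
  exists (fun v => enum_val (f (enum_rank_in v0W v))) => [u v uW vW | v vW].
    move=> /enum_val_inj/f_inj/(congr1 enum_val).
    by rewrite !enum_rankK_in.
  split; first exact: enum_valP.
  by have := Mf (enum_rank_in v0W v); rewrite mxE enum_rankK_in.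
rewrite -kermx_eq0 => /rowV0Pn[u /sub_kermxP uM /rV0Pn[i0 ui0]]; left.
(* Extends [u] by zero: the sum has one term for [e] in [F] and none otherwise. *)
pose y e := \sum_(i | enum_val i == e) u 0 i.
have yE i : y (enum_val i) = u 0 i.
  rewrite /y (bigD1 i) //= big1 ?addr0 // => j /andP[/eqP/enum_val_inj-> ].
  by rewrite eqxx.
have y0 e : e \notin F -> y e = 0.
  move=> eF; apply: big_pred0 => i; apply: contraNF eF => /eqP<-.
  exact: enum_valP.
exists y; split=> //; first by exists (enum_val i0); rewrite yE.
move=> v vW; rewrite (bigID (mem F)) /= [X in _ + X]big1 ?addr0; last first.
  by move=> e /y0->; rewrite mul0r.
rewrite big_enum_val /=; have := congr1 (fun A : 'rV_ _ => A 0 (enum_rank_in vW v)) uM.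
rewrite !mxE => uMv; rewrite -[RHS]uMv; apply: eq_bigr => i _.
by rewrite yE mxE enum_rankK_in.
Qed.

(** * Edge weights in [0, 1] *)

Section Weights.

Variables (E : finType).
Implicit Types (x y : E -> rat) (P : pred E).

Definition fractional x : {set E} := [set e | 0 < x e < 1].

Lemma round_along x y : (forall e, 0 <= x e <= 1) ->
    (exists e, y e != 0) -> (forall e, e \notin fractional x -> y e = 0) ->
  exists2 t : rat, (forall e, 0 <= x e + t * y e <= 1)
    & fractional (fun e => x e + t * y e) \proper fractional x.
Proof.
move=> x01 [e1 ye1] yF.
(* When [y e != 0], [room e] is the largest [t] keeping [x e + t * y e] in [0, 1]. An edge of least
   room ends at 0 or 1. *)
pose room e := (if 0 < y e then 1 - x e else x e) / `|y e|.
have [e ye min_e] := @Order.TotalTheory.arg_minP _ _ _ e1 (fun e => y e != 0) room ye1.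
have t_ge0 : 0 <= room e.
  have := x01 e; rewrite /room; case: ifP => _ /andP[xe0 xe1];
    by rewrite divr_ge0 // subr_ge0.
exists (room e) => [f | ].
  have := x01 f; have := min_e f; rewrite {2}/room.
  have [yf | yf | yf0] := ltgtP 0 (y f); last by rewrite -yf0 mulr0 addr0.
    rewrite gtr0_norm // ler_pdivlMr // => /(_ isT).
    have := mulr_ge0 t_ge0 (ltW yf); lra.
  rewrite ltr0_norm // ler_pdivlMr ?oppr_gt0 // => /(_ isT).
  by have := mulr_ge0_le0 t_ge0 (ltW yf); lra.
apply/properP; split.
  apply/subsetP => f; apply: contraTT => fF; move: (fF).
  by rewrite !inE (yF f fF) mulr0 addr0.
exists e; first by apply: contraNT ye => /yF ->.
rewrite inE /room; have [ye_gt0 | ye_lt0 | ye0] := ltgtP 0 (y e).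
- by rewrite gtr0_norm // divfK // addrC subrK ltxx andbF.
- by rewrite ltr0_norm // invrN mulrN mulNr divfK // subrr ltxx.
- by rewrite -ye0 eqxx in ye.
Qed.

(** Each [x e] lies between [[x e = 1]] and [[x e = 1] + [e fractional]], strictly on both sides if
    [e] is fractional. Since the total is an integer, a strict inequality gains a full unit, whence
    the terms [0 < frac]. *)
Lemma integral_sum_bounds x P n : (forall e, 0 <= x e <= 1) ->
    \sum_(e | P e) x e = n%:R ->
    let ones := #|[set e | P e & x e == 1]| in
    let frac := #|[set e in fractional x | P e]| in
  (ones + (0 < frac) <= n)%N /\ (n + (0 < frac) <= ones + frac)%N.
Proof.
move=> x01 sum_x ones frac.
have cardE Q : #|[set e | P e & Q e]|%:R = \sum_(e | P e) (Q e)%:R :> rat.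
  by rewrite -natr_sum -sum1dep_card big_mkcondr.
have fracE : frac = #|[set e | P e & e \in fractional x]|.
  by apply: eq_card => e; rewrite !inE andbC.
have step e : (x e == 1)%:R <= x e ?= iff (e \notin fractional x)
    /\ x e <= (x e == 1)%:R + (e \in fractional x)%:R ?= iff (e \notin fractional x).
  rewrite inE /Order.leif; have /andP[] := x01 e.
  rewrite !le_eqVlt => /predU1P[<- | x_gt0].
    by rewrite eq_sym oner_eq0 ltxx addr0 eqxx.
  move=> /predU1P[-> | x_lt1]; first by rewrite ltxx andbF addr0 eqxx.
  by rewrite x_gt0 x_lt1 (lt_eqF x_lt1) /= add0r x_lt1 x_gt0 orbT lt_eqF // lt_eqF.
have frac0 : [forall (e | P e), e \notin fractional x] = (frac == 0)%N.
  rewrite cards_eq0; apply/forall_inP/eqP => [xF | F0 e Pe].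
    by apply/setP => e; rewrite in_set0 inE; apply/negP => /andP[eF /xF]; rewrite eF.
  by have := in_set0 e; rewrite -F0 inE Pe andbT => ->.
have := leif_sum (fun e (_ : P e) => (step e).1).
rewrite sum_x -cardE frac0 => -[]; rewrite ler_nat eqr_nat => le1 eq1.
have := leif_sum (fun e (_ : P e) => (step e).2).
rewrite big_split /= sum_x -!cardE -fracE frac0 -natrD => -[].
rewrite ler_nat eqr_nat => le2 eq2.
lia.
Qed.

End Weights.

(** * Rounding in a 3-uniform hypergraph *)

Section Rounding.

Variables (V : finType) (H : hypergraph V).
Hypothesis H_uniform : uniform 3 H.
Implicit Types (x : {set V} -> rat) (v : V).

Let ones x v := #|[set e : {set V} | v \in e & x e == 1]|.
Let frac x v := #|[set e in fractional x | v \in e]|.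

(* The second alternative bounds the final degree of [v] whatever the rounding,
   and is preserved when only fractional weights move. *)
Definition feasible x :=
  [/\ forall e, 0 <= x e <= 1, forall e, e \notin H -> x e = 0
    & forall v, \sum_(e : {set V} | v \in e) x e = 2
                \/ (0 < ones x v)%N /\ (ones x v + frac x v <= 3)%N].

(** As the size of a single set, the count is visibly monotone when fractional weights move, as
    [feasible_rounds] needs. *)
Lemma card_nonzero x v : (ones x v + frac x v)%N =
  #|[set e : {set V} | v \in e & (x e == 1) || (e \in fractional x)]|.
Proof.
pose O := [set e : {set V} | v \in e & x e == 1].
pose F := [set e in fractional x | v \in e].
have : #|O :|: F| = (#|O| + #|F|)%N.
  apply/eqP; rewrite (leq_card_setU O F).2 -setI_eq0; apply/eqP/setP => e.
  by rewrite !inE; case: eqP => [->|]; rewrite ?ltxx ?andbF.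
move=> OF; transitivity #|O :|: F| => //; apply: eq_card => e.
by rewrite !inE; case: (v \in e); rewrite ?andbT ?andbF.
Qed.

(** If the sum is 2, the bounds leave two cases: two ones and no fractional edge, or a single one
    and two fractional edges. *)
Lemma feasible_small x v : feasible x -> (frac x v <= 2)%N ->
  (0 < ones x v)%N /\ (ones x v + frac x v <= 3)%N.
Proof.
move=> [x01 _ xS] le2; have [sum2 | //] := xS v.
have [] := integral_sum_bounds (n := 2) x01 sum2; rewrite -/(ones x v) -/(frac x v).
lia.
Qed.

Lemma feasible_large x v : feasible x -> (2 < frac x v)%N ->
  \sum_(e : {set V} | v \in e) x e = 2 /\ (ones x v <= 1)%N.
Proof.
move=> [x01 _ xS] gt2; have [sum2 | []] := xS v; last by lia.
have [] := integral_sum_bounds (n := 2) x01 sum2; rewrite -/(ones x v) -/(frac x v).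
by split=> //; lia.
Qed.

Lemma sum_frac x : feasible x -> (\sum_v frac x v = #|fractional x| * 3)%N.
Proof.
move=> [_ xH _]; under eq_bigr => v _ do rewrite /frac -sum1dep_card.
rewrite (exchange_big_dep (mem (fractional x))) /=; last by move=> v e _ /andP[].
rewrite -sum_nat_const; apply: eq_bigr => e eF.
rewrite eF -(@H_uniform e) ?sum1_card //; apply: contraTT eF => /xH.
by rewrite inE => ->; rewrite ltxx.
Qed.

Lemma card_large x (W := [set v | (2 < frac x v)%N]) : feasible x ->
  (#|W| <= #|fractional x|)%N /\
  (#|W| = #|fractional x| -> forall v, v \in W -> frac x v = 3).
Proof.
move=> feas_x; have := sum_frac feas_x; rewrite (bigID (mem W)) /=.
have [leW eqW] : (#|W| * 3 <= \sum_(v in W) frac x v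
    ?= iff [forall (v | v \in W), 3 == frac x v])%N.
  by rewrite -sum_nat_const; apply: leqif_sum => v; rewrite inE; apply: leqif_eq.
move=> sumE; split=> [|cardW v vW]; first by lia.
have: [forall (v | v \in W), 3 == frac x v] by rewrite -eqW eqn_leq leW; lia.
by move/forall_inP/(_ v vW)/eqP.
Qed.

Lemma round_matching x (W := [set v | (2 < frac x v)%N]) (g : V -> {set V}) :
    feasible x -> #|W| = #|fractional x| -> {in W &, injective g} ->
    (forall v, v \in W -> g v \in fractional x /\ v \in g v) ->
  exists2 C : hypergraph V, C \subset H &
    forall v, (0 < degree C v <= 3)%N.
Proof.
move=> feas_x cardW g_inj gP; have [_ xH _] := feas_x.
have frac3 := (card_large feas_x).2 cardW.
have pos_H e : 0 < x e -> e \in H.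
  by apply: contraTT => /xH ->; rewrite ltxx.
pose C := [set e | x e == 1] :|: [set g v | v in [set v in W | ones x v == 0%N]].
have CF e : e \in C -> (x e == 1) || (e \in fractional x).
  rewrite !inE => /orP[-> //|/imsetP[v]]; rewrite inE => /andP[vW _] ->.
  by have [+ _] := gP v vW; rewrite inE => ->; rewrite orbT.
exists C.
  apply/subsetP => e /CF; rewrite inE => /orP[/eqP xe1 | /andP[xe0 _]]; apply: pos_H => //.
  by rewrite xe1.
move=> v; pose O := [set e : {set V} | v \in e & x e == 1].
pose F := [set e in fractional x | v \in e].
pose D := [set e in C | v \in e].
have sOD : O \subset D.
  by apply/subsetP => e; rewrite !inE => /andP[-> ->].
have sDOF : D \subset O :|: F.
  apply/subsetP => e; rewrite inE => /andP[/CF]; rewrite !inE.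
  by move=> /orP[] -> ->; rewrite ?orbT.
have leOD : (ones x v <= #|D|)%N := subset_leq_card sOD.
have leOF : (#|O :|: F| <= ones x v + frac x v)%N := (leq_card_setU O F).1.
have leDOF : (#|D| <= #|O :|: F|)%N := subset_leq_card sDOF.
change (0 < #|D| <= 3)%N; have [vW | vW] := boolP (v \in W); last first.
  have [| ones_gt0 le3] := @feasible_small x v feas_x; last by lia.
  by move: vW; rewrite inE -leqNgt.
have [gvF vgv] := gP v vW.
have [_ ones_le1] := feasible_large feas_x (etrans (esym (in_set _ _)) vW).
have F3 := frac3 v vW.
have [ones0 | ones_neq0] := eqVneq (ones x v) 0%N.
  have : (0 < #|D|)%N; last by lia.
  apply/card_gt0P; exists (g v); rewrite !inE vgv andbT; apply/orP; right.
  by apply/imsetP; exists v => //; rewrite inE vW ones0.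
(* Here [v] has a single one and three fractional edges, so one of the four must be dropped. By
   injectivity, no other vertex brings [g v] into [C]. *)
have gvD : g v \notin D.
  move: gvF; rewrite !inE vgv andbT => /andP[_ gv_lt1]; rewrite (lt_eqF gv_lt1) /=.
  apply/imsetP => -[u]; rewrite inE => /andP[uW u0] /g_inj eq_vu.
  by rewrite eq_vu // u0 in ones_neq0.
have : D \subset (O :|: F) :\ g v by rewrite subsetD1 sDOF.
move/subset_leq_card; have := cardsD1 (g v) (O :|: F).
have -> : g v \in O :|: F by rewrite inE (_ : g v \in F) ?orbT // inE gvF.
lia.
Qed.

Lemma feasible_rounds x : feasible x ->
  exists2 C : hypergraph V, C \subset H &
    forall v, (0 < degree C v <= 3)%N.
Proof.
have [k] := ubnP #|fractional x|; elim: k x => // k IHk x le_k feas_x.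
pose W := [set v | (2 < frac x v)%N].
have le_WF : (#|W| <= #|fractional x|)%N := (card_large feas_x).1.
have [] := kernel_or_matching (fun (e : {set V}) v => (v \in e)%:R : rat) set0 le_WF; last first.
  case=> cardW [g g_inj gP]; apply: (round_matching feas_x cardW g_inj) => v /gP[-> ].
  by rewrite pnatr_eq0 eqb0 negbK.
case=> y [y_neq0 yF yW]; have [x01 xH _] := feas_x.
have [t xt01 lt_xt] := round_along x01 y_neq0 yF.
apply: IHk (leq_trans (proper_card lt_xt) le_k) _.
set z := fun e => _ in xt01 lt_xt *.
split=> // [e eH | v].
  by rewrite /z xH // yF ?mulr0 ?addr0 // inE xH // ltxx.
have [vW | vW] := boolP (v \in W).
  left; rewrite /z big_split /= -mulr_sumr.
  have [-> _] := feasible_large feas_x (etrans (esym (in_set _ _)) vW).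
  rewrite (_ : \sum_(e : {set V} | v \in e) y e = 0) ?mulr0 ?addr0 //.
  rewrite -[RHS](yW v vW) big_mkcond; apply: eq_bigr => e _.
  by case: (v \in e); rewrite ?mulr1 ?mulr0.
right; have [| ones_gt0 le3] := @feasible_small x v feas_x.
  by move: vW; rewrite inE -leqNgt.
(* Outside [W], weights 1 persist and no weight 0 becomes nonzero, so both bounds survive the
   move. *)
have zx e : e \notin fractional x -> z e = x e.
  by move=> /yF ye; rewrite /z ye mulr0 addr0.
have le_ones : (ones x v <= ones z v)%N.
  apply/subset_leq_card/subsetP => e; rewrite !inE => /andP[-> /eqP xe1].
  by rewrite zx ?xe1 // inE xe1 ltxx andbF.
split; first exact: leq_trans le_ones.
apply: leq_trans le3; rewrite !card_nonzero.
apply/subset_leq_card/subsetP => e; rewrite inE => /andP[ve ze].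
rewrite inE ve; have [//| eF] := boolP (e \in fractional x); first by rewrite orbT.
case/orP: ze => [|ez]; first by rewrite zx // => ->.
by rewrite (subsetP (proper_sub lt_xt) e ez) in eF.
Qed.

End Rounding.

Close Scope ring_scope.

Theorem theorem1p1 (V : finType) (H : hypergraph V)
    (H_nonempty : nonempty H) (H_regular : regular H) (H_uniform : uniform 3 H) :
  exists C : hypergraph V,
    spanning_subhypergraph C H /\
    forall v : V, degree C v \in [:: 1; 2; 3].
Proof.
have [d H_d] := H_regular; have [e0 e0H] := H_nonempty.
have d_gt0 : 0 < d.
  have /card_gt0P[v ve0] : 0 < #|e0| by rewrite H_uniform.
  by rewrite -(H_d v); apply/card_gt0P; exists e0; rewrite inE e0H.
(* For [d = 1] the weight [2 / d] would exceed 1, but [H] itself works. *)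
have [d1 | d_neq1] := eqVneq d 1.
  by exists H; split=> [|v]; [apply: subxx | rewrite H_d d1].
pose x (e : {set V}) : rat := if e \in H then (2%:R / d%:R)%R else 0%R.
have feas_x : feasible H x.
  have d0 : (d%:R != 0 :> rat)%R by rewrite pnatr_eq0 -lt0n.
  split=> [e | e /negPf eH | v].
  - rewrite /x; case: ifP => // _; rewrite divr_ge0 //.
    by rewrite ler_pdivrMr ?ltr0n // mul1r ler_nat; lia.
  - by rewrite /x eH.
  left; rewrite -big_mkcondr /= sumr_const.
  have -> : #|[pred e : {set V} | (v \in e) && (e \in H)]| = d.
    by rewrite -(H_d v); apply: eq_card => e; rewrite !inE andbC.
  by rewrite -[LHS]mulr_natr divfK.
have [C sCH degC] := feasible_rounds H_uniform feas_x.
by exists C; split=> // v; have := degC v; rewrite !inE; lia.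
Qed.
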